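(* Let $\mathbb K$ be an algebraically closed field of characteristic $0$ and let $(\mathfrak g,B,\omega)$ be a finite-dimensional quadratic symplectic Lie algebra over $\mathbb K$. Then there exist two Lie subalgebras $\mathfrak U$ and $\mathfrak V$ of $\mathfrak g$ such that $(\mathfrak g=\mathfrak U\oplus\mathfrak V,B,\omega)$ is a special symplectic Manin algebra; that is, $\mathfrak g=\mathfrak U\oplus\mathfrak V$ as a vector space, $B(\mathfrak U,\mathfrak U)=B(\mathfrak V,\mathfrak V)=\{0\}$ and $\omega(\mathfrak U,\mathfrak U)=\omega(\mathfrak V,\mathfrak V)=\{0\}$.
   Context: A quadratic symplectic Lie algebra $(\mathfrak g,B,\omega)$ is a Lie algebra $\mathfrak g$ with a non-degenerate symmetric bilinear form $B$ such that $B([x,y],z)=B(x,[y,z])$ for all $x,y,z$, and a non-degenerate skew-symmetric bilinear form $\omega$ such that $\omega([x,y],z)+\omega([y,z],x)+\omega([z,x],y)=0$ for all $x,y,z$. No further compatibility between $B$ and $\omega$ is required. A Manin algebra $(\mathfrak g=\mathfrak U\oplus\mathfrak V,B)$ is a quadratic Lie algebra $(\mathfrak g,B)$ which is the vector space direct sum of two Lie subalgebras $\mathfrak U,\mathfrak V$ with $B(\mathfrak U,\mathfrak U)=B(\mathfrak V,\mathfrak V)=\{0\}$. It is a special symplectic Manin algebra, with symplectic structure $\omega$, if moreover $\omega(\mathfrak U,\mathfrak U)=\omega(\mathfrak V,\mathfrak V)=\{0\}$. *)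

(* Defs.v *)
From mathcomp Require Import all_boot all_algebra.

Set Implicit Arguments.
Unset Strict Implicit.
Unset Printing Implicit Defensive.

Import GRing.Theory.
Local Open Scope ring_scope.

Definition is_lie_bracket (K : fieldType) (g : vectType K)
    (br : {bilinear g -> g -> g}) : Prop :=
  (forall x, br x x = 0) /\
  (forall x y z, br x (br y z) + br y (br z x) + br z (br x y) = 0).

Definition lie_subalgebra (K : fieldType) (g : vectType K)
    (br : {bilinear g -> g -> g}) (U : {vspace g}) : Prop :=
  {in U &, forall x y, br x y \in U}.

Definition quadratic_lie_algebra (K : fieldType) (g : vectType K)
    (br : {bilinear g -> g -> g}) (B : {symmetric g}) : Prop :=
  [/\ is_lie_bracket br, nondegenerate B &
      forall x y z, B (br x y) z = B x (br y z)].

Definition symplectic_structure (K : fieldType) (g : vectType K)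
    (br : {bilinear g -> g -> g}) (omega : {skew_symmetric g}) : Prop :=
  nondegenerate omega /\
  forall x y z, omega (br x y) z + omega (br y z) x + omega (br z x) y = 0.

Definition quadratic_symplectic_lie_algebra (K : fieldType) (g : vectType K)
    (br : {bilinear g -> g -> g}) (B : {symmetric g})
    (omega : {skew_symmetric g}) : Prop :=
  quadratic_lie_algebra br B /\ symplectic_structure br omega.

Definition totally_isotropic (K : fieldType) (g : vectType K)
    (f : g -> g -> K) (U : {vspace g}) : Prop :=
  {in U &, forall x y, f x y = 0}.

Definition manin_algebra (K : fieldType) (g : vectType K)
    (br : {bilinear g -> g -> g}) (B : {symmetric g})
    (U V : {vspace g}) : Prop :=
  [/\ quadratic_lie_algebra br B,
      lie_subalgebra br U /\ lie_subalgebra br V,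
      (U + V)%VS = fullv /\ directv (U + V) &
      totally_isotropic B U /\ totally_isotropic B V].

Definition special_symplectic_manin_algebra (K : fieldType) (g : vectType K)
    (br : {bilinear g -> g -> g}) (B : {symmetric g})
    (omega : {skew_symmetric g}) (U V : {vspace g}) : Prop :=
  [/\ manin_algebra br B U V, symplectic_structure br omega,
      totally_isotropic omega U & totally_isotropic omega V].

(* Main.v *)
Require Import Defs.
From HB Require Import structures.
From Stdlib Require Import Classical_Prop.
From mathcomp Require Import all_boot all_algebra.

Set Implicit Arguments.
Unset Strict Implicit.
Unset Printing Implicit Defensive.

Import GRing.Theory.
Local Open Scope ring_scope.

(** The nondegenerate form B turns omega into an operator D, by
    omega(x,y) = B(Dx,y) ([exists_operator_between_forms]).  Skew-symmetry of
    omega makes D skew for B, the cocycle identity together with the invariance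
    of B makes D a derivation, and nondegeneracy of omega makes D injective.

    Over an algebraically closed field the Lie algebra is the sum of the
    generalized eigenspaces g_a of D ([sum_lgeigenspace_full]).  A skew operator
    forces g_a and g_b to be orthogonal, for B and for omega, as soon as a + b
    is nonzero ([gen_eigen_pairing]), and a derivation satisfies
    [g_a, g_b] <= g_{a+b} ([gen_eigen_bracket]).  As D is injective, 0 is not an
    eigenvalue.

    So it is enough to split the eigenvalues into positive and negative ones: in
    characteristic 0 the additive group of the field is torsion-free, hence
    signs can be chosen so that no nonempty sum of signed eigenvalues vanishes
    ([exists_pointed_cone]).  Let U be the sum of the g_a over the positive a,
    and V the sum over the negative ones.  A sum of two positive weights is
    nonzero, so U and V are isotropic for both forms.  Together they span
    everything, hence nondegeneracy gives that U and V meet trivially and that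
    each is its own B-orthogonal.  Therefore U is a subalgebra because
    B([x,y],w) = 0 for x, y, w in U, which holds since a sum of three positive
    weights is nonzero ([weight_sum_subalgebra]); likewise for V.  This detour through B covers
    without distinction the case where a + b is not an eigenvalue. *)

(** * Sign choices in a torsion-free abelian group *)

(** The additive semigroup generated by [t].  The empty sum is excluded, so that
    [~ cone t 0] expresses that the entries of [t] are positive for a common
    partial order compatible with addition. *)
Inductive cone {V : zmodType} (t : seq V) : V -> Prop :=
| cone_gen x of x \in t : cone t x
| coneD x y of cone t x & cone t y : cone t (x + y).

Lemma cone_neq0 (V : zmodType) (t : seq V) (x : V) :
  ~ cone t 0 -> cone t x -> x != 0.
Proof. by move=> t0 tx; apply/eqP => x0; apply: t0; rewrite -x0. Qed.

Lemma cone_opp (V : zmodType) (t : seq V) (x : V) :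
  cone (map -%R t) x -> cone t (- x).
Proof.
elim=> {x} [_ /mapP[y ty ->]|x y _ tx _ ty].
  by rewrite opprK; apply: cone_gen.
by rewrite opprD; apply: coneD.
Qed.

Lemma coneMn (V : zmodType) (t : seq V) (x : V) (n : nat) :
  cone t x -> (0 < n)%N -> cone t (x *+ n).
Proof.
move=> tx; case: n => // n _; elim: n => [|n IHn] //.
by rewrite mulrS; apply: coneD.
Qed.

Lemma cone_cons (V : zmodType) (t : seq V) (x y : V) :
  cone (x :: t) y ->
  cone t y \/ exists n, (0 < n)%N /\ (y = x *+ n \/ cone t (y - x *+ n)).
Proof.
elim=> {y} [y|y z _ IHy _ IHz].
  rewrite inE => /predU1P[->|ty]; last by left; apply: cone_gen.
  by right; exists 1%N; split=> //; left.
case: IHy => [ty|[n [n_gt0 yP]]].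
  case: IHz => [tz|[m [m_gt0 zP]]]; first by left; apply: coneD.
  right; exists m; split=> //; right; case: zP => [->|tz].
    by rewrite addrK.
  by rewrite -addrA; apply: coneD.
right; case: IHz => [tz|[m [m_gt0 zP]]].
  exists n; split=> //; right; case: yP => [->|ty].
    by rewrite addrAC subrr add0r.
  by rewrite addrAC; apply: coneD.
exists (n + m)%N; split; first by rewrite addn_gt0 n_gt0.
rewrite mulrnDr opprD addrACA.
case: yP zP => [->|ty] [->|tz]; first by left.
- by right; rewrite subrr add0r.
- by right; rewrite subrr addr0.
- by right; apply: coneD.
Qed.

(** If adjoining x and adjoining -x both produced 0, then some -(n x) and some
    m x would already lie in the cone, and so would
    0 = n (m x) + m (- n x). *)
Lemma pointed_cone_cons (V : zmodType) (t : seq V) (x : V) :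
  (forall n, (0 < n)%N -> x *+ n <> 0) -> ~ cone t 0 ->
  ~ cone (x :: t) 0 \/ ~ cone (- x :: t) 0.
Proof.
move=> x_free t0; case: (classic (cone (x :: t) 0)) => [tx0|]; last by left.
right=> tNx0; case: (cone_cons tx0) => // -[n [n_gt0 []]].
  by move=> /esym; apply: (x_free n n_gt0).
rewrite sub0r => tNnx; case: (cone_cons tNx0) => // -[m [m_gt0 []]].
  by move=> /esym/eqP; rewrite mulNrn oppr_eq0 => /eqP; apply: (x_free m m_gt0).
rewrite sub0r mulNrn opprK => tmx; apply: t0.
have -> : 0 = (x *+ m) *+ n + (- (x *+ n)) *+ m :> V.
  by rewrite mulNrn -!mulrnA mulnC subrr.
by apply: coneD; apply: coneMn.
Qed.

(** Adjoin the elements of [s] one by one, each with a sign that keeps the cone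
    pointed.  Membership in a cone of an arbitrary group is not decidable, so
    the choice of the sign is classical. *)
Lemma exists_pointed_cone (V : zmodType) (s : seq V) :
  {in s, forall x n, (0 < n)%N -> x *+ n <> 0} ->
  exists2 t : seq V, ~ cone t 0 & {in s, forall x, x \in t \/ - x \in t}.
Proof.
elim: s => [_|x s IHs s_free].
  exists [::] => // t0.
  suff: forall y : V, ~ cone [::] y by move/(_ 0).
  by move=> y; elim.
have [y sy|t t0 st] := IHs; first by apply: s_free; rewrite inE sy orbT.
have [] := pointed_cone_cons (x := x) (s_free x (mem_head _ _)) t0 => t'0.
  exists (x :: t) => // y; rewrite !inE => /predU1P[->|/st[]->].
  - by left; rewrite eqxx.
  - by left; rewrite orbT.
  - by right; rewrite orbT.
exists (- x :: t) => // y; rewrite !inE => /predU1P[->|/st[]->].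
- by right; rewrite eqxx.
- by left; rewrite orbT.
- by right; rewrite orbT.
Qed.

(** * Generalized eigenvectors *)

Section GenEigen.

Context {K : fieldType} {g : vectType K} (D : 'End(g)).

(** Being killed by a power of D - a, without naming the exponent: the inductions
    below are then inductions on the annihilating power. *)
Inductive gen_eigen (a : K) : g -> Prop :=
| gen_eigen0 : gen_eigen a 0
| gen_eigenS x of gen_eigen a (D x - a *: x) : gen_eigen a x.

Lemma gen_eigen_shift a x : gen_eigen a x -> gen_eigen a (D x - a *: x).
Proof.
by case=> //; rewrite linear0 scaler0 subr0; apply: gen_eigen0.
Qed.

Lemma gen_eigenD a x y : gen_eigen a x -> gen_eigen a y -> gen_eigen a (x + y).
Proof.
move=> ax; elim: ax y => {x} [|x _ IHx] y ay; first by rewrite add0r.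
apply: gen_eigenS; rewrite linearD scalerDr opprD addrACA.
exact/IHx/gen_eigen_shift.
Qed.

(** By skewness, f((D - a)x, y) + f(x, (D - b)y) = - (a + b) f(x,y), and the left
    side vanishes by induction on the powers that kill x and y. *)
Lemma gen_eigen_pairing (eps : bool) (f : {hermitian g for eps & idfun})
    (a b : K) (x y : g) :
  (forall u v, f (D u) v = - f u (D v)) -> a + b != 0 ->
  gen_eigen a x -> gen_eigen b y -> f x y = 0.
Proof.
move=> fD ab0 ax; elim: ax y => {x} [|x _ IHx] y; first by rewrite linear0l.
move=> by_; elim: by_ (by_) => {y} [|y _ IHy] by_; first by rewrite linear0r.
have := IHx y by_; have := IHy (gen_eigen_shift by_).
rewrite linearBr linearBl linearZl_LR linearZr_LR /= fD => fxy /eqP.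
rewrite -opprD oppr_eq0 -(subrK (b * f x y) (f x (D y))) fxy add0r -mulrDl.
by rewrite mulf_eq0 addrC (negPf ab0) => /eqP.
Qed.

(** The Leibniz rule gives
    (D - (a + b))[x,y] = [(D - a)x, y] + [x, (D - b)y], and both summands are
    generalized eigenvectors of weight a + b by induction. *)
Lemma gen_eigen_bracket (br : {bilinear g -> g -> g}) (a b : K) (x y : g) :
  (forall u v, D (br u v) = br (D u) v + br u (D v)) ->
  gen_eigen a x -> gen_eigen b y -> gen_eigen (a + b) (br x y).
Proof.
move=> brD ax; elim: ax y => {x} [|x _ IHx] y.
  by rewrite linear0l => _; apply: gen_eigen0.
move=> by_; elim: by_ (by_) => {y} [|y _ IHy] by_.
  by rewrite linear0r; apply: gen_eigen0.
apply: gen_eigenS.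
have -> : D (br x y) - (a + b) *: br x y =
          br (D x - a *: x) y + br x (D y - b *: y).
  rewrite brD linearBl linearBr linearZl_LR linearZr_LR /= scalerDl opprD.
  by rewrite addrACA.
apply: gen_eigenD; first exact: IHx.
exact/IHy/gen_eigen_shift.
Qed.

End GenEigen.

(** * Generalized eigenspace decomposition *)

(** [geigenspace] is phrased with powers in a matrix ring, which exist in positive
    size only; iterating a map on rows has no such restriction. *)
Lemma geigenspace_iter (K : fieldType) (n : nat) (A : 'M[K]_n) (a : K)
    (v : 'rV_n) :
  (v <= geigenspace A a)%MS -> iter n (fun w => w *m A - a *: w) v = 0.
Proof.
case: n A v => [|n] A v; first by rewrite thinmx0.
rewrite geigenspaceE => /sub_kermxP vA0.
suff iterE k (w : 'rV_n.+1) :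
    iter k (fun w => w *m A - a *: w) w = w *m (A - a%:M) ^+ k.
  by rewrite iterE.
elim: k w => [|k IHk] w; first by rewrite mulmx1.
by rewrite iterSr IHk exprS mulmxA mulmxBr mul_mx_scalar.
Qed.

(** By Cayley-Hamilton, A is annihilated by the product of the (X - a)^n over the
    distinct eigenvalues a; these factors are pairwise coprime, so the kernel of
    the product, which is everything, is the sum of their kernels. *)
Lemma sum_geigenspace_full (K : closedFieldType) (n : nat) (A : 'M[K]_n) :
  exists2 s : seq K, {in s, forall a, eigenvalue A a} &
    (1%:M <= \sum_(a <- s) geigenspace A a)%MS.
Proof.
case: n A => [|n] A; first by exists [::] => //; rewrite thinmx0 sub0mx.
have [r] := closed_field_poly_normal (char_poly A).
rewrite (monicP (char_poly_monic A)) scale1r => Dp.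
have sz_r : size r = n.+1.
  by apply: succn_inj; rewrite -(size_prod_XsubC r id) -Dp size_char_poly.
exists (undup r) => [a|].
  by rewrite mem_undup eigenvalue_root_char Dp root_prod_XsubC.
rewrite (big_nth 0) big_mkord.
pose p (i : 'I_(size (undup r))) := ('X - ((undup r)`_i)%:P) ^+ n.+1.
have p_co i j : j != i -> coprimep (p i) (p j).
  move=> ji; rewrite coprimep_expr ?coprimep_expl // coprimep_XsubC root_XsubC.
  by rewrite nth_uniq ?undup_uniq // eq_sym.
have Asum := kermxpoly_prod A (P := predT) (p_ := p) (fun i j _ _ => p_co i j).
suff /kermxpoly_min Amin : mxminpoly A %| \prod_i p i.
  have : (1%:M <= kermxpoly A (\prod_i p i))%MS by rewrite Amin.
  by rewrite Asum.
apply: dvdp_trans (mxminpoly_dvd_char A) _; rewrite Dp.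
(* A root of the characteristic polynomial has multiplicity at most its degree. *)
rewrite -big_undup_iterop_count /p.
rewrite -(big_mkord xpredT (fun i => ('X - ((undup r)`_i)%:P) ^+ n.+1)).
rewrite -(big_nth 0 xpredT (fun z => ('X - z%:P) ^+ n.+1)).
elim/big_ind2: _ => [|p1 q1 p2 q2|a _]; first exact: dvdpp.
  exact: dvdp_mul.
rewrite -[iterop _ _ _ _]/(_ ^+ count_mem a r).
by apply: dvdp_exp2l; rewrite -sz_r count_size.
Qed.

Import passmx.

Definition lgeigenspace {K : fieldType} {g : vectType K} (D : 'End(g)) (a : K) :
    {vspace g} :=
  let e := vbasis {:g} in vsof e (geigenspace (mxof e e D) a).

Lemma lgeigenspace_gen_eigen (K : fieldType) (g : vectType K) (D : 'End(g))
    (a : K) (x : g) :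
  x \in lgeigenspace D a -> gen_eigen D a x.
Proof.
have eB := vbasisP {:g}; rewrite -rVof_sub // => /geigenspace_iter.
elim: {3}(\dim _) x => [|k IHk] x.
  by move/eqP; rewrite /= rVof_eq0 // => /eqP->; apply: gen_eigen0.
rewrite iterSr -rVof_app // -linearZ -linearB => /IHk.
exact: gen_eigenS.
Qed.

Lemma sum_lgeigenspace_full (K : closedFieldType) (g : vectType K)
    (D : 'End(g)) : lker D = 0%VS ->
  exists2 s : seq K, 0 \notin s &
    (\sum_(a <- s) lgeigenspace D a)%VS = fullv.
Proof.
move=> D_inj; have eB := vbasisP {:g}; set e := vbasis {:g} in eB.
have [s s_eig s_full] := sum_geigenspace_full (mxof e e D).
exists s.
  apply/negP => /s_eig; rewrite /eigenvalue -(vsof_eq0 eB) -leigenspaceE //.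
  by rewrite /leigenspace scale0r subr0 D_inj eqxx.
set W := (\sum_(a <- s) _)%VS; apply/eqP; rewrite eqEsubv subvf /=.
have <- : vsof e 1%:M = fullv by rewrite /vsof hommx1 // lim1g.
rewrite vsof_sub //; apply: submx_trans s_full _.
rewrite (big_nth 0) big_mkord; apply/sumsmx_subP => i _.
rewrite -vsof_sub // /W (big_nth 0) big_mkord.
exact: (sumv_sup i).
Qed.

(** * Bilinear forms and the operator relating them *)

Lemma nondegenerateP (K : fieldType) (g : vectType K) (eps : bool)
    (f : {hermitian g for eps & idfun}) (x : g) :
  nondegenerate f -> (forall y, f x y = 0) -> x = 0.
Proof.
move=> /eqP f_nd fx0; apply/eqP; rewrite -memv0 -f_nd.
by apply/mem_orthovP => y _; apply: fx0.
Qed.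

(** Nondegeneracy makes x |-> B(.,x) an isomorphism onto the dual space, so
    omega(.,x) is of the form B(.,z) with z linear in x. *)
Lemma exists_operator_between_forms (K : fieldType) (g : vectType K)
    (B : {symmetric g}) (omega : {skew_symmetric g}) :
  nondegenerate B ->
  exists D : 'End(g), forall x y, omega x y = B (D x) y.
Proof.
move=> B_nd.
pose F (eps : bool) (f : {hermitian g for eps & idfun}) (x : g) :
  'Hom(g, K^o) := linfun (applyr f x : g -> K^o).
have FE eps f x y : F eps f x y = f y x by rewrite lfunE.
have F_lin eps f : linear (F eps f).
  by move=> c u v; apply/lfunP => y; rewrite add_lfunE scale_lfunE !FE linearPr.
pose FL eps f := GRing.isLinear.Build _ _ _ _ (F eps f) (F_lin eps f).
pose beta : {linear g -> 'Hom(g, K^o)} := HB.pack (F false B) (FL false B).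
pose gamma : {linear g -> 'Hom(g, K^o)} := HB.pack (F true omega) (FL true omega).
have beta_inj : lker (linfun beta) == 0%VS.
  rewrite -subv0; apply/subvP => x; rewrite memv_ker lfunE memv0 => /eqP Bx.
  apply/eqP/(nondegenerateP (f := B)) => // y; rewrite hermC /= -FE.
  by rewrite -[F _ _ _]/(beta x) Bx lfunE mulr0.
(* An injective map into the dual is onto, by equality of dimensions. *)
have beta_surj : limg (linfun beta) = fullv.
  apply/eqP; rewrite eqEdim subvf limg_dim_eq ?(eqP beta_inj) ?capv0 //=.
  by rewrite !dimvf /dim /= muln1.
(* The sign undoes the exchange of arguments: omega is skew, B symmetric. *)
exists (- ((linfun beta)^-1 \o linfun gamma))%VF => x y.
rewrite opp_lfunE comp_lfunE.
set z := _ (linfun gamma x).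
have /(congr1 (fun h : 'Hom(g, K^o) => h y)) : beta z = gamma x.
  have := limg_lfunVK (f := linfun beta) (x := linfun gamma x).
  by rewrite beta_surj memvf -/z lfunE [in RHS]lfunE; apply.
rewrite -[beta z]/(F _ _ z) -[gamma x]/(F _ _ x) !FE => Bz.
rewrite linearNl /= hermC mulN1r -Bz; congr (- _).
by rewrite hermC mul1r.
Qed.

(** If x = u + v is orthogonal to U, then v is orthogonal to U as well as to V. *)
Lemma isotropic_complement_perp (K : fieldType) (g : vectType K)
    (B : {symmetric g}) (U V : {vspace g}) (x : g) :
  nondegenerate B -> totally_isotropic B U -> totally_isotropic B V ->
  (U + V)%VS = fullv -> {in U, forall w, B x w = 0} -> x \in U.
Proof.
move=> B_nd BU BV UV Bx.
have /memv_addP[u Uu [v Vv Dx]] : x \in (U + V)%VS by rewrite UV memvf.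
rewrite Dx (nondegenerateP (f := B) (x := v)) ?addr0 // => y.
have /memv_addP[u' Uu' [v' Vv' ->]] : y \in (U + V)%VS by rewrite UV memvf.
rewrite linearDr /= (BV v v') // addr0 -[v](addKr u) -Dx linearDl linearNl /=.
by rewrite Bx // BU // oppr0 addr0.
Qed.

(** * Sums of generalized eigenspaces over a pointed set of weights *)

Lemma sumv_ind (K : fieldType) (g : vectType K) (I : eqType) (t : seq I)
    (G : I -> {vspace g}) (P : g -> Prop) :
  P 0 -> (forall x y, P x -> P y -> P (x + y)) ->
  (forall a x, a \in t -> x \in G a -> P x) ->
  forall x, x \in (\sum_(a <- t) G a)%VS -> P x.
Proof.
move=> P0 PD; elim: t => [|a t IHt] PG x.
  by rewrite big_nil memv0 => /eqP->.
rewrite big_cons => /memv_addP[y ay [z tz ->]].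
apply: PD; first by apply: (PG a); rewrite ?mem_head.
by apply: IHt tz => b w tb; apply: PG; rewrite inE tb orbT.
Qed.

Definition weight_sum {K : fieldType} {g : vectType K} (D : 'End(g))
    (t : seq K) : {vspace g} := (\sum_(a <- t) lgeigenspace D a)%VS.

Lemma mem_weight_sum (K : fieldType) (g : vectType K) (D : 'End(g))
    (t : seq K) (a : K) (x : g) :
  a \in t -> x \in lgeigenspace D a -> x \in weight_sum D t.
Proof.
rewrite /weight_sum => + ax; elim: t => // b t IHt.
rewrite inE big_cons => /predU1P[<-|/IHt].
  exact: (subvP (addvSl _ _)).
exact: (subvP (addvSr _ _)).
Qed.

Lemma weight_sum_isotropic (K : fieldType) (g : vectType K) (D : 'End(g))
    (t : seq K) (eps : bool) (f : {hermitian g for eps & idfun}) :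
  (forall u v, f (D u) v = - f u (D v)) -> ~ cone t 0 ->
  totally_isotropic f (weight_sum D t).
Proof.
move=> fD t0 x y tx ty; move: x tx.
apply: sumv_ind => [|x x' fx fx'|a x ta ax]; first by rewrite linear0l.
  by rewrite linearDl /= fx fx' addr0.
move: y ty; apply: sumv_ind => [|y y' fy fy'|b y tb by_].
- by rewrite linear0r.
- by rewrite linearDr /= fy fy' addr0.
have ab0 : a + b != 0 by apply: cone_neq0 t0 _; apply: coneD; apply: cone_gen.
by apply: (gen_eigen_pairing fD ab0); apply: lgeigenspace_gen_eigen.
Qed.

(** For x, y, w of weights a, b, c, the bracket [x,y] has weight a + b, and
    a + b + c is in the cone, hence nonzero; so [x,y] is orthogonal to w. *)
Lemma weight_sum_subalgebra (K : fieldType) (g : vectType K) (D : 'End(g))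
    (br : {bilinear g -> g -> g}) (B : {symmetric g}) (t : seq K) :
  (forall u v, D (br u v) = br (D u) v + br u (D v)) ->
  (forall u v, B (D u) v = - B u (D v)) ->
  (forall x, {in weight_sum D t, forall w, B x w = 0} -> x \in weight_sum D t) ->
  ~ cone t 0 -> lie_subalgebra br (weight_sum D t).
Proof.
move=> brD BD perp t0 x y tx ty; apply: perp => w tw.
move: x tx; apply: sumv_ind => [|x x' fx fx'|a x ta ax].
- by rewrite linear0l linear0l.
- by rewrite linearDl /= linearDl /= fx fx' addr0.
move: y ty; apply: sumv_ind => [|y y' fy fy'|b y tb by_].
- by rewrite linear0r linear0l.
- by rewrite linearDr /= linearDl /= fy fy' addr0.
move: w tw; apply: sumv_ind => [|w w' fw fw'|c w tc cw].
- by rewrite linear0r.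
- by rewrite linearDr /= fw fw' addr0.
have abc0 : (a + b) + c != 0.
  by apply: cone_neq0 t0 _; apply: coneD; [apply: coneD|]; apply: cone_gen.
apply: (gen_eigen_pairing BD abc0).
  by apply: gen_eigen_bracket => //; apply: lgeigenspace_gen_eigen.
exact: lgeigenspace_gen_eigen.
Qed.

Theorem proposition5p6 (K : closedFieldType) (charK0 : [pchar K] =i pred0)
    (g : vectType K) (br : {bilinear g -> g -> g})
    (B : {symmetric g}) (omega : {skew_symmetric g})
    (hg : quadratic_symplectic_lie_algebra br B omega) :
  exists U V : {vspace g}, special_symplectic_manin_algebra br B omega U V.
Proof.
have [qB sympl] := hg; have [_ B_nd B_inv] := qB.
have [omega_nd omega_cocycle] := sympl.
have [D DE] := exists_operator_between_forms omega B_nd.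
have BC x y : B x y = B y x by rewrite hermC mul1r.
have omegaC x y : omega x y = - omega y x by rewrite hermC mulN1r.
have BD u v : B (D u) v = - B u (D v) by rewrite -DE omegaC DE BC.
have omegaD u v : omega (D u) v = - omega u (D v) by rewrite !DE BD.
have brD u v : D (br u v) = br (D u) v + br u (D v).
  apply/subr0_eq/(nondegenerateP (f := B)) => // z.
  rewrite linearBl linearDl /= -DE B_inv -DE.
  have -> : B (br u (D v)) z = omega v (br z u).
    by rewrite DE (BC _ z) -B_inv BC.
  have /eqP := omega_cocycle u v z.
  rewrite -addrA addr_eq0 => /eqP->.
  by rewrite opprD -!omegaC subrr.
have D_inj : lker D = 0%VS.
  apply/eqP; rewrite -subv0; apply/subvP => x; rewrite memv_ker memv0 => /eqP Dx.
  apply/eqP/(nondegenerateP (f := omega)) => // y.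
  by rewrite DE Dx linear0l.
have [s s0 s_full] := sum_lgeigenspace_full D_inj.
have [|t t0 st] := exists_pointed_cone (s := s).
  move=> a sa n n_gt0 /eqP; rewrite -mulr_natl mulf_eq0.
  rewrite ((pcharf0P K).1 charK0) eqn0Ngt n_gt0 /= => /eqP a0.
  by rewrite -a0 sa in s0.
set U := weight_sum D t; set V := weight_sum D (map -%R t).
have UV : (U + V)%VS = fullv.
  apply/eqP; rewrite eqEsubv subvf -s_full; apply/subvP.
  apply: sumv_ind => [|x y|a x /st[ta|ta] ax]; first exact: mem0v.
  - exact: memvD.
  - exact/(subvP (addvSl U V))/mem_weight_sum/ax.
  - apply/(subvP (addvSr U V))/mem_weight_sum/ax.
    by rewrite -[a]opprK map_f.
have Nt0 : ~ cone (map -%R t) 0.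
  by move=> /cone_opp; rewrite oppr0.
have [BU BV] : totally_isotropic B U /\ totally_isotropic B V.
  by split; apply: weight_sum_isotropic.
exists U, V; split=> //; try exact: weight_sum_isotropic.
split=> //; first split.
- apply: (weight_sum_subalgebra (B := B)) => // x.
  exact: (isotropic_complement_perp B_nd BU BV UV).
- apply: (weight_sum_subalgebra (B := B)) => // x.
  by apply: (isotropic_complement_perp B_nd BV BU); rewrite addvC.
split=> //; apply/directv_addP/eqP; rewrite -subv0.
apply/subvP => x; rewrite memv_cap memv0 => /andP[Ux Vx]; apply/eqP.
apply: (nondegenerateP (f := B)) => // y.
have /memv_addP[u Uu [v Vv ->]] : y \in (U + V)%VS by rewrite UV memvf.
by rewrite linearDr /= BU // BV // addr0.
Qed.
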